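(* Let $K$ be a field of characteristic not $2$, let $f \in K[x]$ have even degree $d$, and let $t \in K$ be not periodic under $f$, with $f^{\circ m}(x) - t$ separable for all $m \geq 1$. For $m \geq 0$ let $K_m$ be the splitting field of $f^{\circ m}(x) - t$ over $K$. Suppose that for some integer $n \geq 1$ the extension $K_{n-1}/K$ is maximal, and that for every root $\alpha$ of $f^{\circ (n-1)}(x) - t$ the polynomial $f(x) - \alpha$ is irreducible over $K(\alpha)$ and the Galois group of its splitting field over $K(\alpha)$, acting on its roots, is $S_d$ or $A_d$. Then $K_n/K$ is maximal if and only if $\operatorname{disc}(f^{\circ n}(x) - t) \notin K_{n-1}^{\times 2}$.
   Context: $f^{\circ m}$ is the $m$-th iterate of $f$, $f^{\circ 0}(x)=x$. Let $T_m$ be the rooted tree whose vertices are the roots (in a separable closure of $K$) of $f^{\circ j}(x)-t$ for $0 \leq j \leq m$ (level $j$; root $t$), with an edge between $\alpha,\beta$ whenever $f(\alpha)=\beta$; it is a complete rooted $d$-ary tree of depth $m$. $\operatorname{Gal}(K_m/K)$ acts faithfully on $T_m$ by tree automorphisms, hence embeds in $\operatorname{Aut}(T_m)$; the extension $K_m/K$ is called maximal if $\operatorname{Gal}(K_m/K) = \operatorname{Aut}(T_m)$ under this embedding. *)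

(* Defs.v *)
From HB Require Import structures.
From mathcomp Require Import all_boot all_order all_algebra all_fingroup.
From mathcomp Require Import all_solvable all_field.

Set Implicit Arguments.
Unset Strict Implicit.
Unset Printing Implicit Defensive.

Import GRing.Theory.
Local Open Scope ring_scope.

Definition fiter (K : fieldType) (f : {poly K}) (m : nat) : {poly K} :=
  iter m (fun g => f \Po g) 'X.

Definition periodic (K : fieldType) (f : {poly K}) (t : K) : Prop :=
  exists2 m, (0 < m)%N & (fiter f m).[t] = t.

(* [L] stands for any extension of [K] that contains the roots in question;
   it plays the role of the separable closure. *)
Definition lift_poly (K : fieldType) (L : splittingFieldType K) (p : {poly K})
  : {poly L} := map_poly (in_alg L) p.

(* [rs] lists the roots of [p] with multiplicity; in particular [p] splits. *)
Definition roots_of (F : fieldType) (p : {poly F}) (rs : seq F) : Prop :=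
  p = lead_coef p *: \prod_(z <- rs) ('X - z%:P).

(* disc p = a^(2d-2) \prod_(i < j) (z_i - z_j)^2, where a is the leading
   coefficient and z_0, ..., z_(d-1) are the roots of p. The value does not
   depend on the order of the roots. *)
Definition disc (F : fieldType) (p : {poly F}) (rs : seq F) : F :=
  lead_coef p ^+ (2 * (size rs).-1) *
  \prod_(i < size rs) \prod_(j < size rs | (i < j)%N) (rs`_i - rs`_j) ^+ 2.

Definition nonzero_square_in (K : fieldType) (L : splittingFieldType K)
    (E : {subfield L}) (x : L) : Prop :=
  exists y : L, [/\ y \in E, y != 0 & x = y ^+ 2].

(* [vsproj E] is the identity on E, so the second component speaks of [p]
   itself, seen as a polynomial over the field [subvs_of E]. *)
Definition irreducible_over (K : fieldType) (L : splittingFieldType K)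
    (E : {subfield L}) (p : {poly L}) : Prop :=
  p \is a polyOver E /\ irreducible_poly (map_poly (vsproj E) p).

(* The permutations of the roots (through their indices in [rs]) induced by
   Gal(E(rs) / E). *)
Definition gal_perms (K : fieldType) (L : splittingFieldType K)
    (E : {subfield L}) (rs : seq L) : {set 'S_(size rs)} :=
  [set s : 'S_(size rs) |
    [exists u in 'Gal(<<E & rs>>%AS / E)%g,
      [forall i : 'I_(size rs), u rs`_i == rs`_(s i)]]].

Definition gal_sym_or_alt (K : fieldType) (L : splittingFieldType K)
    (E : {subfield L}) (p : {poly L}) : Prop :=
  exists2 rs : seq L, roots_of p rs &
    gal_perms E rs = [set: 'S_(size rs)] \/
    gal_perms E rs = ('Alt_('I_(size rs)))%g.

Section PreimageTree.

Variables (K : fieldType) (L : splittingFieldType K).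
Variables (f : {poly K}) (t : K) (m : nat).

Definition is_vertex (x : L) : bool :=
  [exists j : 'I_m.+1, root (lift_poly L (fiter f j - t%:P)) x].

Definition vertex : Type := {x : L | is_vertex x}.

Definition edge (x y : vertex) : bool :=
  ((lift_poly L f).[val x] == val y) || ((lift_poly L f).[val y] == val x).

Definition tree_aut (s : vertex -> vertex) : Prop :=
  [/\ bijective s,
      forall x, val x = t%:A -> val (s x) = t%:A
    & forall x y, edge (s x) (s y) = edge x y].

(* The image of Gal(E / K) in the permutations of the vertices is Aut(T_m);
   used with E the splitting field of f^m - t. *)
Definition maximal_ext (E : {subfield L}) : Prop :=
  forall s : vertex -> vertex,
    tree_aut s <->
    exists2 u, u \in 'Gal(E / 1%AS)%g & forall x, val (s x) = u (val x).

End PreimageTree.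

(* Main.v *)
Require Import Defs.
From HB Require Import structures.
From mathcomp Require Import all_boot all_order all_algebra all_fingroup.
From mathcomp Require Import all_solvable all_field.

Set Implicit Arguments.
Unset Strict Implicit.
Unset Printing Implicit Defensive.

Import GRing.Theory.

(** Label the children of every vertex by ['I_d], so that the vertices of T_n
    become words of length at most n. An element h of H = Gal(K_n / K_(n-1))
    induces a permutation rho_w(h) in S_d of the children of each word w of
    length n - 1, and K_n / K is maximal iff every family of permutations is
    realised by H. A Vandermonde determinant is a square root of the
    discriminant up to a factor in K^*, and h multiplies it by the product of
    the signs of the rho_w(h); so the discriminant is a non-square in K_(n-1)
    iff some h has an odd number of odd rho_w(h).

    Given such an h, the sign vectors of H form an F_2-space that is stable
    under Aut(T_(n-1)), by maximality of K_(n-1), and contains a vector of odd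
    weight; since d is even, it is the whole space. Hence rho_w(H) contains odd
    permutations. It is normal in the Galois group of f - alpha_w over
    K(alpha_w), which is thus S_d and not A_d, and a normal subgroup of S_d with
    an odd element is S_d. A Goursat argument then shows that H realises all
    families. *)

(** * Permutation groups *)

Section Permutations.
Local Open Scope group_scope.
Variable T : finType.
Implicit Types (a b c : T) (p s : {perm T}).

Lemma perm_move_triple a b c a' b' c' :
    a != b -> a != c -> b != c -> a' != b' -> a' != c' -> b' != c' ->
  exists p, [/\ p a = a', p b = b' & p c = c'].
Proof.
move=> ab ac bc ab' ac' bc'.
(* Each transposition puts one more point in place and fixes the targets already reached. *)
pose p1 := tperm a a'; pose p2 := tperm (p1 b) b'; pose p3 := tperm (p2 (p1 c)) c'.
have p1a : p1 a = a' by rewrite tpermL.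
have p2a : p2 a' = a'.
  by apply: tpermD; rewrite eq_sym // -p1a (inj_eq perm_inj).
have p2b : p2 (p1 b) = b' by rewrite tpermL.
have p3a : p3 a' = a'.
  by apply: tpermD; rewrite eq_sym // -{1}p2a -p1a !(inj_eq perm_inj).
have p3b : p3 b' = b'.
  by apply: tpermD; rewrite eq_sym // -{1}p2b !(inj_eq perm_inj).
exists (p1 * p2 * p3); rewrite !permM p1a p2a p3a p2b p3b; split=> //.
exact: tpermL.
Qed.

Lemma perm_move_pair a b a' b' :
  a != b -> a' != b' -> exists p, p a = a' /\ p b = b'.
Proof.
move=> ab ab'; pose p1 := tperm a a'; pose p2 := tperm (p1 b) b'.
have p1a : p1 a = a' by rewrite tpermL.
exists (p1 * p2); rewrite !permM p1a tpermL; split=> //.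
by apply: tpermD; rewrite eq_sym // -p1a (inj_eq perm_inj).
Qed.

(** An even permutation is a product of an even number of transpositions, which are split off two at
    a time. *)
Lemma even_perm_in (N : {group {perm T}}) :
    (forall a b c d, a != b -> c != d -> tperm a b * tperm c d \in N) ->
  forall p, ~~ odd_perm p -> p \in N.
Proof.
move=> tt p; have [ts -> dts] := prod_tpermP p; rewrite odd_perm_prod //.
have [k] := ubnP (size ts); elim: k ts dts => // k IHk [|t [|u ts]] //=.
  by rewrite big_nil group1.
case/and3P=> dt du dts ltk; rewrite !negbK => even_ts.
by rewrite !big_cons mulgA groupM ?tt // IHk // ltnW.
Qed.

(** Commutators of [s] with transpositions, and their conjugates, yield a 3-cycle in [N], unless
    there are only two points or [s] is a double transposition on four points, which is even. So
    small degrees are covered too. *)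
Lemma normal_odd_full (N : {group {perm T}}) s :
    (forall p q, q \in N -> q ^ p \in N) -> s \in N -> odd_perm s ->
  forall p, p \in N.
Proof.
move=> nN Ns odd_s.
have comm x y : tperm (s x) (s y) * tperm x y \in N.
  rewrite -tpermJ conjgE -!mulgA groupM ?groupV // mulgA.
  by have := nN (tperm x y) s Ns; rewrite conjgE tpermV mulgA.
(* One 3-cycle gives all of them by conjugation, as any three points can be moved to any three; for
   [x = z] the product is trivial. *)
have spread a b c : a != b -> a != c -> b != c -> tperm a b * tperm a c \in N ->
    forall x y z, x != y -> y != z -> tperm x y * tperm y z \in N.
  move=> ab ac bc Nabc x y z xy yz.
  have [-> | xz] := eqVneq x z; first by rewrite [tperm z y]tpermC tperm2 group1.
  have [|p [<- <- <-]] := @perm_move_triple a b c y x z ab ac bc _ yz xz.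
    by rewrite eq_sym.
  by rewrite [tperm (p b) _]tpermC -!tpermJ -conjMg nN.
(* The other products reduce to these: (a b)(c d) is (a b)(b c) times (b c)(c d). *)
suffices shared x y z : x != y -> y != z -> tperm x y * tperm y z \in N.
  have even_in : forall p, ~~ odd_perm p -> p \in N.
    apply: even_perm_in => a b c d ab cd.
    case: (eqVneq b c) cd => [<- | bc] cd; first exact: shared.
    have := groupM (shared a b c ab bc) (shared b c d bc cd).
    by rewrite mulgA -(mulgA (tperm a b)) tperm2 mulg1.
  move=> p; case odd_p: (odd_perm p); last by rewrite even_in ?odd_p.
  by rewrite -(groupMr _ Ns) even_in // odd_permM odd_p odd_s.
move: x y z; have [x /andP[sx ssx] | invol] :=
    pickP [pred x | (s x != x) && (s (s x) != x)].
  apply: (spread (s x) (s (s x)) x); rewrite ?(inj_eq perm_inj) //.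
    by rewrite eq_sym.
  by rewrite [tperm (s x) x]tpermC comm.
have ss x : s (s x) = x.
  by have /= := invol x; case: eqVneq => [sx _ | _ /= /negbFE/eqP //]; rewrite !sx.
have [x sx | s1] := pickP [pred x | s x != x]; last first.
  suff s_id : s = 1 by rewrite s_id odd_perm1 in odd_s.
  by apply/permP=> x; rewrite perm1; have /= /negbFE/eqP := s1 x.
rewrite /= in sx; have [u /andP[ux usx] | only_xs] :=
    pickP [pred u | (u != x) && (u != s x)]; last first.
  move=> a b c ab bc.
  have [-> | ac] := eqVneq a c; first by rewrite [tperm c b]tpermC tperm2 group1.
  have in_xs y : (y == x) || (y == s x).
    by have /= /negbT := only_xs y; rewrite negb_and !negbK.
  case/orP: (in_xs a) (in_xs b) (in_xs c) ab bc ac => /eqP->;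
    by case/orP=> /eqP-> /orP[] /eqP->; rewrite eqxx.
have [su | su] := eqVneq (s u) u.
  have := comm x u; rewrite su => Nxu.
  apply: (spread u (s x) x) => //.
  by rewrite [tperm u _]tpermC [tperm u x]tpermC.
have sux : s u != x by apply: contra usx => /eqP <-; rewrite ss.
have susx : s u != s x by rewrite (inj_eq perm_inj).
have [w /and4P[wx wsx wu wsu] | only4] :=
    pickP [pred w | [&& w != x, w != s x, w != u & w != s u]].
  (* Conjugation by the transposition of [u] with the fifth point [w] changes only one factor, and
     the quotient is a 3-cycle. *)
  have N1 := comm x u.
  have := nN (tperm u w) _ N1; rewrite conjMg !tpermJ tpermL.
  have usu : u != s u by rewrite eq_sym.
  rewrite (@tpermD _ u w (s x)) // (@tpermD _ u w (s u)) //.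
  rewrite (@tpermD _ u w x) // => N2.
  have := groupM (groupVr N1) N2; rewrite invMg !tpermV.
  rewrite -mulgA (mulgA (tperm (s x) _)) tperm2 mul1g => N3.
  by apply: (spread x u w); rewrite // eq_sym.
(* Without a fifth point [s] is a product of two transpositions, against its odd sign. *)
have def_s : s = tperm x (s x) * tperm u (s u).
  apply/permP=> y; rewrite permM.
  have [-> | yx] := eqVneq y x; first by rewrite tpermL tpermD.
  have [-> | ysx] := eqVneq y (s x).
    by rewrite ss tpermR tpermD.
  rewrite (@tpermD _ x (s x) y) 1?eq_sym //.
  have [-> | yu] := eqVneq y u; first by rewrite tpermL.
  have := only4 y; rewrite /= yx ysx yu /= => /negbFE/eqP ->.
  by rewrite ss tpermR.
by move: odd_s; rewrite def_s odd_permM !odd_tperm eq_sym sx eq_sym su.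
Qed.

End Permutations.

(** * Subdirect products of symmetric groups, and signs of block permutations *)

Section SubdirectProduct.
Local Open Scope group_scope.

(* Goursat's lemma: the only obstruction to lifting a family of permutations
   one more coordinate is a normal subgroup of even permutations, and a
   product of commutators is even in every coordinate. *)
Lemma subdirect_perm_full (gT : finGroupType) (H : {group gT}) (D T : finType)
    (rho : D -> {morphism H >-> {perm T}}) :
    (forall a s, exists2 h, h \in H & rho a h = s) ->
    (forall e : D -> bool,
       exists2 h, h \in H & forall a, odd_perm (rho a h) = e a) ->
  forall p : D -> {perm T}, exists2 h, h \in H & forall a, rho a h = p a.
Proof.
move=> rho_onto rho_sign.
suffices lift_seq (r : seq D) : uniq r -> forall p : D -> {perm T},
    exists2 h, h \in H & {in r, forall a, rho a h = p a}.
  move=> p; have [h Hh rho_h] := lift_seq _ (enum_uniq D) p.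
  by exists h => // a; rewrite rho_h ?mem_enum.
elim: r => [_ p | a r IHr]; first by exists 1; rewrite ?group1.
case/andP=> ar uniq_r p; have {}IHr := IHr uniq_r.
(* The kernel on the coordinates in [r]; it has to map onto all permutations under [rho a]. *)
pose A := [set h in H | all (fun b => rho b h == 1) r].
have gA : group_set A.
  apply/group_setP; split.
    by rewrite inE group1; apply/allP=> b _; rewrite morph1.
  move=> x y /setIdP[Hx /allP rx] /setIdP[Hy /allP ry].
  rewrite inE groupM //; apply/allP=> b rb.
  by rewrite morphM // (eqP (rx b rb)) (eqP (ry b rb)) mulg1.
pose GA := Group gA.
have sAH : GA \subset H by apply/subsetP=> x /setIdP[].
(* The commutator of lifts of (x y) and of a permutation carrying x, y to z, w equals (x y)(z w) at
   [b], is trivial on the rest of [r], and is even at [a] like every commutator. *)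
have comm_in b : b \in r -> forall s, ~~ odd_perm s ->
    exists2 k, k \in H & ~~ odd_perm (rho a k) /\
      {in r, forall c, rho c k = if c == b then s else 1}.
  move=> rb.
  pose E := [set s | [exists k in H, ~~ odd_perm (rho a k) &&
               all (fun c => rho c k == if c == b then s else 1) r]].
  have gE : group_set E.
    apply/group_setP; split.
      rewrite inE; apply/existsP; exists 1; rewrite group1 (morph1 (rho a)) odd_perm1 /=.
      by apply/allP=> c _; rewrite morph1 if_same.
    move=> x y; rewrite !inE => /existsP[h /and3P[Hh ha /allP hr]].
    case/existsP=> k /and3P[Hk ka /allP kr].
    apply/existsP; exists (h * k); rewrite groupM // morphM // odd_permM.
    rewrite (negPf ha) (negPf ka) /=; apply/allP=> c rc.
    rewrite morphM // (eqP (hr c rc)) (eqP (kr c rc)).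
    by case: ifP => //; rewrite mulg1.
  suffices evenE s : ~~ odd_perm s -> s \in Group gE.
    move=> s /evenE; rewrite inE => /existsP[k /and3P[Hk ka /allP kr]].
    by exists k => //; split=> // c /kr/eqP.
  apply: even_perm_in => x y z w xy zw.
  have [g [gx gy]] := perm_move_pair xy zw.
  have [h Hh hr] := IHr (fun c => if c == b then tperm x y else 1).
  have [k Hk kr] := IHr (fun c => if c == b then g else 1).
  rewrite inE; apply/existsP; exists [~ h, k]; rewrite groupR //=.
  rewrite morphR // !odd_permM !odd_permV.
  rewrite [_ (+) (_ (+) _)]addbCA addKb addbb /=.
  apply/allP=> c rc; rewrite morphR // hr // kr //.
  case: ifP => _; last by rewrite comm1g.
  by rewrite commgEl tpermV tpermJ gx gy.
have even_lift (q : D -> {perm T}) : {in r, forall b, ~~ odd_perm (q b)} ->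
    exists2 k, k \in H & ~~ odd_perm (rho a k) /\ {in r, forall b, rho b k = q b}.
  move=> even_q.
  suffices lift_sub (r' : seq D) : uniq r' -> {subset r' <= r} ->
      exists2 k, k \in H & ~~ odd_perm (rho a k) /\
        {in r, forall b, rho b k = if b \in r' then q b else 1}.
    have [//|k Hk [ka kr]] := lift_sub r uniq_r.
    by exists k => //; split=> // b rb; rewrite kr // rb.
  elim: r' => [_ _ | b r' IH /=].
    exists 1; rewrite ?group1 // (morph1 (rho a)) odd_perm1.
    by split=> // b _; rewrite morph1.
  case/andP=> br' uniq_r' sub_r'.
  have rb : b \in r by rewrite sub_r' ?mem_head.
  have [|k Hk [ka kr]] := IH uniq_r'.
    by move=> c r'c; rewrite sub_r' // inE r'c orbT.
  have [h Hh [ha hr]] := comm_in b rb (q b) (even_q b rb).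
  exists (h * k); rewrite ?groupM // morphM // odd_permM (negPf ha) (negPf ka).
  split=> // c rc; rewrite morphM // hr // kr // inE.
  by case: eqVneq => [-> | _] /=; rewrite ?(negPf br') ?mulg1 ?mul1g.
(* As [h] is odd at [a] only, some [k] agrees with it on [r] while being even at [a]; then
   [h * k^-1] lies in the kernel [A] and is odd at [a]. *)
have [h Hh odd_h] := rho_sign (pred1 a).
have [k Hk [ka kr]] : exists2 k, k \in H & ~~ odd_perm (rho a k) /\
    {in r, forall b, rho b k = rho b h}.
  apply: even_lift => b rb; rewrite odd_h /=.
  by apply: contraNneq ar => <-.
(* The image of [A] is normal because [rho a] maps [H] onto the whole symmetric group. *)
have full : forall s, s \in [group of rho a @* GA].
  apply: (@normal_odd_full _ _ (rho a (h * k^-1))).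
  - move=> s q /morphimP[x Hx Ax ->].
    have [g Hg <-] := rho_onto a s.
    rewrite -morphJ //; apply: mem_morphim; first exact: groupJ.
    case/setIdP: Ax => _ /allP rx; apply/setIdP; split; first exact: groupJ.
    by apply/allP=> b rb; rewrite morphJ // (eqP (rx b rb)) conj1g.
  - have Hhk : h * k^-1 \in H by rewrite groupM ?groupV.
    apply: mem_morphim => //; apply/setIdP; split=> //.
    by apply/allP=> b rb; rewrite morphM ?groupV // morphV // kr // mulgV.
  by rewrite morphM ?groupV // morphV // odd_permM odd_permV odd_h /= eqxx (negPf ka).
have [g Hg rg] := IHr p.
have /morphimP[x Hx /setIdP[_ /allP Ax] def_x] := full ((rho a g)^-1 * p a).
exists (g * x); first exact: groupM.
move=> b; rewrite inE morphM //; case/orP=> [/eqP-> | rb].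
  by rewrite -def_x mulKVg.
by rewrite rg // (eqP (Ax b rb)) mulg1.
Qed.

(** [s] is the product of permutations [q a] that act as [p a] on the block of [a] and fix the other
    blocks; [q a] copies a decomposition of [p a] into transpositions, hence has its sign. *)
Lemma odd_perm_block (D T U : finType) (e : D * T -> U) (s : {perm U})
    (p : D -> {perm T}) :
    bijective e -> (forall a i, s (e (a, i)) = e (a, p a i)) ->
  odd_perm s = \big[addb/false]_a odd_perm (p a).
Proof.
move=> bij_e sE; have inj_e := bij_inj bij_e.
have /fin_all_exists[q qP] a : exists q : {perm U},
    odd_perm q = odd_perm (p a) /\
    forall b i, q (e (b, i)) = if b == a then e (a, p a i) else e (b, i).
  have [ts -> dts] := prod_tpermP (p a).
  elim: ts dts => [_ | [x y] ts IH /= /andP[xy /IH[q [odd_q qE]]]].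
    exists 1; rewrite !big_nil !odd_perm1; split=> // b i.
    by rewrite !perm1; case: eqVneq => [-> | //].
  exists (tperm (e (a, x)) (e (a, y)) * q); rewrite !big_cons !odd_permM odd_q.
  rewrite !odd_tperm (inj_eq inj_e) xpair_eqE eqxx /=; split=> // b i.
  rewrite !permM; case: (eqVneq b a) => [-> | ba].
    have -> : tperm (e (a, x)) (e (a, y)) (e (a, i)) = e (a, tperm x y i).
      by apply/esym/(@inj_tperm _ _ (fun j => e (a, j))) => j k /inj_e[].
    by rewrite qE eqxx.
  rewrite tpermD ?qE ?(negPf ba) // (inj_eq inj_e) xpair_eqE.
    by rewrite eq_sym (negPf ba).
  by rewrite eq_sym (negPf ba).
have -> : s = \prod_a q a.
  apply/permP=> u; have [e' eK e'K] := bij_e; rewrite -(e'K u).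
  case: (e' u) => b i; rewrite sE.
  suffices prodE (r : seq D) : uniq r -> (\prod_(a <- r) q a) (e (b, i)) =
      if b \in r then e (b, p b i) else e (b, i).
    by rewrite prodE ?index_enum_uniq // mem_index_enum.
  elim: r => [_ | a r IH /= /andP[ar uniq_r]]; first by rewrite big_nil perm1.
  rewrite big_cons permM (qP a).2 inE; case: eqVneq => [-> | ba] /=; last exact: IH.
  suffices out (r' : seq D) j :
      a \notin r' -> (\prod_(b <- r') q b) (e (a, j)) = e (a, j).
    by rewrite out.
  elim: r' => [|c r' IH']; first by rewrite big_nil perm1.
  rewrite inE negb_or => /andP[ac /IH' IHc]; rewrite big_cons permM (qP c).2.
  by rewrite (negPf ac).
rewrite (big_morph _ (@odd_permM U) (@odd_perm1 U)).
by apply: eq_bigr => a _; rewrite (qP a).1.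
Qed.

End SubdirectProduct.

(** * The tree of words *)

Section Words.
Variable T : finType.
Implicit Types (w x y : seq T) (p : {perm T}).

(* The automorphism of the tree of words that permutes by [p] the branches
   at the node [w]. *)
Fixpoint node_move w p x : seq T :=
  match w, x with
  | [::], i :: y => p i :: y
  | j :: w', i :: y => if j == i then i :: node_move w' p y else x
  | _, [::] => [::]
  end.

Lemma size_node_move w p x : size (node_move w p x) = size x.
Proof.
elim: w x => [|j w IH] [|i x] //=.
by case: ifP => //= _; rewrite IH.
Qed.

Lemma node_move_short w p x : size x <= size w -> node_move w p x = x.
Proof.
elim: w x => [|j w IH] [|i x] //= lexw.
by case: ifP => //= _; rewrite IH.
Qed.

Lemma node_move_rcons w p x i :
  node_move w p (rcons x i) =
  rcons (node_move w p x) (if x == w then p i else i).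
Proof.
elim: w x => [|j w IH] [|k x] //=.
  by case: w {IH} => [|? ?] /=; rewrite if_same.
rewrite eqseq_cons [k == j]eq_sym; case: ifP => //= _.
by rewrite IH.
Qed.

Lemma node_moveK w p : cancel (node_move w p) (node_move w p^-1).
Proof.
elim: w => [|j w IH] [|i x] //=; first by rewrite permK.
by case: ifP => [/eqP<- | ji] /=; rewrite ?eqxx ?ji ?IH.
Qed.

Lemma node_moveKV w p : cancel (node_move w p^-1) (node_move w p).
Proof. by move=> x; rewrite -{1}(invgK p) node_moveK. Qed.

Lemma big_tuple_rcons (m : nat) (v : seq T -> bool) :
  \big[addb/false]_(x : m.+1.-tuple T) v x =
  \big[addb/false]_(w : m.-tuple T) \big[addb/false]_i v (rcons w i).
Proof.
rewrite pair_big /= (reindex (fun wi : m.-tuple T * T => [tuple of rcons wi.1 wi.2])) //.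
apply: onW_bij; apply: inj_card_bij; last first.
  by rewrite card_prod !card_tuple expnSr.
move=> [w i] [w' i'] /(congr1 val) /= /rcons_inj[eq_w ->].
by congr (_, _); apply: val_inj.
Qed.

(* Let [W] be an F_2-space of vectors indexed by the words of length [m],
   stable under the node moves. By induction on [m], the block sums of [W] are
   arbitrary; as [T] has even cardinality, a block with odd sum is not
   constant, and adding its image by a transposition leaves two entries. *)
Lemma odd_submodule_full (m : nat) (W : (seq T -> bool) -> Prop) :
    ~~ odd #|T| ->
    (forall v v', (forall x, size x = m -> v x = v' x) -> W v -> W v') ->
    (forall v v', W v -> W v' -> W (fun x => v x (+) v' x)) ->
    (forall v w p, size w < m -> W v -> W (fun x => v (node_move w p x))) ->
    (exists2 v, W v & \big[addb/false]_(x : m.-tuple T) v x) ->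
  forall v, W v.
Proof.
move=> evenT; elim: m W => [|m IHm] W Wext Wadd Wmove [v0 Wv0 odd_v0] v.
  have W0 : W (fun=> false) by apply: Wext (Wadd _ _ Wv0 Wv0) => x _; rewrite addbb.
  have v0nil : v0 [::].
    have: \big[addb/false]_(x : 0.-tuple T) v0 x = v0 [::].
      by rewrite (bigD1 [tuple]) //= big1 ?addbF // => x; rewrite [x]tuple0 => /eqP.
    by move <-.
  case v_nil: (v [::]); [apply: Wext Wv0 | apply: Wext W0];
    by move=> x /size0nil ->; rewrite v_nil.
have W0 : W (fun=> false) by apply: Wext (Wadd _ _ Wv0 Wv0) => x _; rewrite addbb.
have Wsum (I : finType) (F : I -> seq T -> bool) : (forall i, W (F i)) ->
    W (fun x => \big[addb/false]_i F i x).
  move=> WF; elim: (index_enum I) => [|i r IHr].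
    by apply: Wext W0 => x _; rewrite big_nil.
  by apply: Wext (Wadd _ _ (WF i) IHr) => x _; rewrite big_cons.
(* The block sums of [W] form a space of the same kind one level up: a move at a word shorter than
   [m] permutes whole blocks, and the total sum is unchanged. *)
have blocks u : exists2 z, W z &
    forall w, size w = m -> u w = \big[addb/false]_i z (rcons w i).
  move: u; apply: (IHm (fun u => exists2 z, W z &
      forall w, size w = m -> u w = \big[addb/false]_i z (rcons w i))).
  - by move=> u u' uu' [z Wz uz]; exists z => // w sw; rewrite -uu' ?uz.
  - move=> u u' [z Wz uz] [z' Wz' uz'].
    exists (fun x => z x (+) z' x); first exact: Wadd.
    by move=> w sw; rewrite uz ?uz' ?big_split.
  - move=> u w p sw [z Wz uz]; exists (fun x => z (node_move w p x)).
      by apply: Wmove => //; apply: ltnW.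
    move=> x sx; rewrite uz ?size_node_move //; apply: eq_bigr => i _.
    by rewrite node_move_rcons; case: eqP sw => // <-; rewrite sx ltnn.
  exists (fun w => \big[addb/false]_i v0 (rcons w i)); first by exists v0.
  by rewrite -big_tuple_rcons.
have pairs w i k : size w = m -> i != k ->
    W (fun x => (x == rcons w i) (+) (x == rcons w k)).
  move=> sw ik; have [z Wz /(_ w sw)] := blocks (pred1 w).
  rewrite /= eqxx => odd_z.
  have [i0 [k0 zik]] : exists i0 k0, z (rcons w i0) != z (rcons w k0).
    have [k0 zk0 | same] := pickP (fun k0 => z (rcons w i) != z (rcons w k0)).
      by exists i, k0.
    move: odd_z.
    rewrite (eq_bigr (fun=> z (rcons w i))) => [|j _]; last first.
      by have /negbFE/eqP := same j.
    have iter_addb c b : iter c (addb b) false = odd c && b.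
      by elim: c => //= c ->; case: (odd c); case: b.
    by rewrite big_const iter_addb (negPf evenT).
  have ik0 : i0 != k0 by apply: contraNneq zik => ->.
  (* The two surviving entries sit at [i0] and [k0]; a further move at [w] brings them to [i] and
     [k]. *)
  have [g [gi gk]] := perm_move_pair ik ik0.
  have Wz2 := Wadd _ _ Wz (Wmove _ w (tperm i0 k0) _ Wz).
  apply: (Wext _ _ _ (Wmove _ w g _ (Wz2 _))); rewrite ?sw // => x.
  case/lastP: x => // y j; rewrite size_rcons => -[sy].
  rewrite !node_move_rcons !(@node_move_short w) ?sy ?sw //.
  case: eqVneq => [-> | yw]; last first.
    by rewrite addbb !eqseq_rcons (negPf yw).
  rewrite !eqseq_rcons eqxx /= -(inj_eq (@perm_inj _ g) j i) gi.
  rewrite -(inj_eq (@perm_inj _ g) j k) gk.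
  case: tpermP => [-> | -> | /eqP/negPf-> /eqP/negPf->]; last by rewrite addbb.
    by rewrite eqxx (negPf ik0); move: zik; do 2!case: (z _).
  by rewrite eqxx eq_sym (negPf ik0); move: zik; do 2!case: (z _).
have Weven u : (forall w, size w = m -> \big[addb/false]_i u (rcons w i) = false) ->
    W u.
  move=> even_u.
  (* [u] is the sum of the pairs joining each of its entries to a base letter [i0] in the same
     block; the extra terms at [i0] add up to the block sum, which is zero. *)
  have [i0 _ | T0] := pickP (@predT T); last first.
    apply: Wext W0 => x; case/lastP: x => // y j; by have := T0 j.
  pose F (wi : m.-tuple T * T) x := u (rcons wi.1 wi.2) &&
    ((x == rcons wi.1 wi.2) (+) (x == rcons wi.1 i0)).
  apply: (Wext (fun x => \big[addb/false]_wi F wi x)); last first.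
    apply: Wsum => -[w i]; rewrite /F /=; case: (u _) => //=.
    have [-> | ii0] := eqVneq i i0; first by apply: Wext W0 => x _; rewrite addbb.
    by apply: pairs; rewrite ?size_tuple.
  move=> x; case/lastP: x => // y j; rewrite size_rcons => -[sy].
  have sy' : size y == m by apply/eqP.
  rewrite -(pair_bigA _ (fun (w : m.-tuple T) i => u (rcons w i) &&
     ((rcons y j == rcons w i) (+) (rcons y j == rcons w i0)))) /=.
  rewrite (bigD1 (Tuple sy')) //= [X in _ (+) X]big1 => [|w wy]; last first.
    rewrite big1 // => i _; rewrite !eqseq_rcons.
    have /negPf-> : y != w by apply: contra wy => /eqP yw; apply/eqP/val_inj.
    by rewrite andbF.
  rewrite addbF.
  rewrite (eq_bigr (fun i => (u (rcons y i) && (j == i)) (+)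
                             (u (rcons y i) && (j == i0)))).
    rewrite big_split /= -big_distrl /= even_u // addbF.
    rewrite (bigD1 j) //= eqxx andbT big1 ?addbF // => i ij.
    by rewrite eq_sym (negPf ij) andbF.
  by move=> i _; rewrite !eqseq_rcons eqxx /= andb_addr.
have [z Wz bz] := blocks (fun w => \big[addb/false]_i v (rcons w i)).
apply: Wext (Wadd _ _ Wz (Weven (fun x => z x (+) v x) _)) => [x _ | w sw].
  by rewrite addKb.
by rewrite big_split /= -bz // addbb.
Qed.

End Words.

(** * Maps of words that respect parents *)

Section WordMap.
Variable T : eqType.
Implicit Types (S : seq T -> seq T) (m : nat).

(** Bijectivity is left out: an automorphism is given as a pair of such maps, inverse to each other
    on words of length at most [m]. *)
Definition word_map m S : Prop :=
  S [::] = [::] /\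
  forall x i, size x < m -> exists k, S (rcons x i) = rcons (S x) k.

Lemma size_word_map m S x : word_map m S -> size x <= m -> size (S x) = size x.
Proof.
case=> S0 SS; elim/last_ind: x => [|x i IH]; first by rewrite S0.
rewrite size_rcons => ltxm; have [k ->] := SS x i ltxm.
by rewrite !size_rcons IH // ltnW.
Qed.

Lemma word_mapW m m' S : m' <= m -> word_map m S -> word_map m' S.
Proof. by move=> le [S0 SS]; split=> // x i lt; apply: SS; apply: leq_trans le. Qed.

End WordMap.

Lemma node_move_word_map (T : finType) (m : nat) (w : seq T) p :
  word_map m (node_move w p).
Proof.
split=> [|x i _]; first by case: w.
by rewrite node_move_rcons; eexists.
Qed.

Local Open Scope ring_scope.

(** * Labelling the preimage tree *)

Section Iterates.
Variables (K : fieldType) (L : splittingFieldType K) (f : {poly K}) (t : K).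
Implicit Types (m : nat) (x a : L).

Local Notation F := (lift_poly L f).
Local Notation Fi m := (lift_poly L (fiter f m - t%:P)).
Local Notation it m x := (iter m (fun y => F.[y]) x).

Lemma horner_lift_fiter m x : (lift_poly L (fiter f m)).[x] = it m x.
Proof.
elim: m => [|m IH]; first by rewrite /lift_poly map_polyX hornerX.
by rewrite /lift_poly /= map_comp_poly horner_comp -/(lift_poly L _) IH.
Qed.

Lemma root_lift_fiter m x : root (Fi m) x = (it m x == t%:A).
Proof.
rewrite /root -horner_lift_fiter /lift_poly rmorphB /= map_polyC /=.
by rewrite hornerD hornerN hornerC subr_eq0.
Qed.

Lemma iter_lift_in_alg m : it m (t%:A : L) = (fiter f m).[t]%:A.
Proof. by rewrite -horner_lift_fiter /lift_poly (horner_map (in_alg L)). Qed.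

(** Non-periodicity is used in this form; it keeps the levels of the tree disjoint. *)
Lemma iter_nonperiodic m : ~ periodic f t -> it m (t%:A : L) = t%:A -> m = 0%N.
Proof.
case: m => // m nonper; rewrite iter_lift_in_alg => eq_t.
by case: nonper; exists m.+1 => //; apply: (fmorph_inj (in_alg L)).
Qed.

Lemma fiterSr m : fiter f m.+1 = fiter f m \Po f.
Proof.
elim: m => [|m IH]; first by rewrite /= comp_polyX comp_polyXr.
by rewrite -[LHS]/(f \Po fiter f m.+1) {1}IH comp_polyA.
Qed.

End Iterates.

(** [gal_sym_or_alt] speaks of indices in some list of roots; this passes to a given labelling [r]
    and to automorphisms of [L]. In the alternating case only the parity is kept. *)
Lemma gal_sym_or_alt_labels (K : fieldType) (L : splittingFieldType K)
    (E : {subfield L}) (p : {poly L}) (k : nat) (r : 'I_k -> L) :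
    p != 0 -> injective r -> p = lead_coef p *: \prod_i ('X - (r i)%:P) ->
    gal_sym_or_alt E p ->
  (forall s : 'S_k, exists2 g : 'AEnd(L),
     {in E, forall x, g x = x} & forall i, g (r i) = r (s i)) \/
  (forall (g : 'AEnd(L)) (s : 'S_k), {in E, forall x, g x = x} ->
     (forall i, g (r i) = r (s i)) -> ~~ odd_perm s).
Proof.
move=> p0 inj_r Dr [rs Drs galrs].
have eq_rs : perm_eq rs (codom r).
  apply: prod_XsubC_eq; rewrite -lead_coef_eq0 in p0.
  apply: (scalerI p0); rewrite -Drs Dr lead_coefZ.
  rewrite (monicP (monic_prod_XsubC _ _ _)) mulr1; congr (_ *: _).
  by rewrite big_image.
have sz_rs : size rs = k by rewrite (perm_size eq_rs) size_codom card_ord.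
have uniq_rs : uniq rs by rewrite (perm_uniq eq_rs); apply/injectiveP.
have /fin_all_exists[e De] (j : 'I_(size rs)) : exists i, rs`_j = r i.
  have : rs`_j \in codom r by rewrite -(perm_mem eq_rs) mem_nth.
  by case/codomP=> i ->; exists i.
have inj_e : injective e.
  move=> j j' /(congr1 r); rewrite -!De => /eqP.
  by rewrite nth_uniq // => /eqP/val_inj.
have bij_e : bijective e by apply: inj_card_bij; rewrite ?card_ord ?sz_rs.
have [e' eK e'K] := bij_e.
have sEQ := subv_adjoin_seq E rs.
case: galrs => galrs; [left=> s | right=> g s gE gs].
  have inj_s : injective (fun j => e' (s (e j))).
    by move=> j j' /(can_inj e'K)/perm_inj/inj_e.
  have : perm inj_s \in gal_perms E rs by rewrite galrs inE.
  rewrite inE => /exists_inP[u Gu /forallP us]; exists (u : 'AEnd(L)).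
    by move=> x Ex; apply: (fixed_gal sEQ Gu).
  move=> i; have /eqP := us (e' i).
  by rewrite permE !De !e'K.
have inj_s : injective (fun j => e' (s (e j))).
  by move=> j j' /(can_inj e'K)/perm_inj/inj_e.
(* [g] permutes the roots, so it restricts to an element of Gal(E(rs) / E). *)
have autg : kAut E <<E & rs>> g.
  rewrite kAutE; apply/andP; split; first by apply/kAHomP.
  rewrite aimg_adjoin_seq; apply: subv_trans (adjoin_seqSl _ _) (adjoin_seqSr _ _).
    by apply/subvP=> _ /memv_imgP[x Ex ->]; rewrite gE.
  move=> _ /mapP[x rs_x ->]; rewrite (perm_mem eq_rs).
  rewrite (perm_mem eq_rs) in rs_x; case/codomP: rs_x => i ->.
  by rewrite gs codom_f.
have [u Gu gu] := kAut_to_gal autg.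
have : perm inj_s \in gal_perms E rs.
  rewrite inE; apply/exists_inP; exists u => //; apply/forallP=> j.
  by rewrite -gu ?seqv_sub_adjoin ?mem_nth // permE !De gs e'K.
(* Relabelling preserves the sign: the case of a single block. *)
rewrite galrs Alt_even (@odd_perm_block unit _ _ (fun ai => e' ai.2) _ (fun=> s)).
- by rewrite big_const card_unit /= addbF.
- by exists (fun j => (tt, e j)) => [[[] i]|j] /=; rewrite ?e'K ?eK.
by move=> [] i; rewrite permE /= e'K.
Qed.

(** * Words as names of the vertices *)

Section Labels.
Variables (K : fieldType) (L : splittingFieldType K) (f : {poly K}) (t : K).
Variable n : nat.
Local Notation F := (lift_poly L f).
Local Notation Fi m := (lift_poly L (fiter f m - t%:P)).
Local Notation it m x := (iter m (fun y => F.[y]) x).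
Local Notation d := (size f).-1.

Hypothesis f_nonconst : (1 < size f)%N.
Hypothesis t_nonper : ~ periodic f t.
Hypothesis sep : forall m, (0 < m)%N -> separable_poly (fiter f m - t%:P).
Hypothesis splits : forall m, (m <= n)%N ->
  exists rs : seq L, Fi m %= \prod_(z <- rs) ('X - z%:P).

Lemma size_lift_sub (a : L) : size (F - a%:P) = d.+1.
Proof.
rewrite size_polyDl ?size_map_poly ?prednK //; first exact: ltnW.
by rewrite size_polyN size_polyC (leq_ltn_trans _ f_nonconst) // leq_b1.
Qed.

Lemma lead_coef_lift_sub (a : L) : lead_coef (F - a%:P) = lead_coef F.
Proof.
rewrite lead_coefDl // size_polyN size_polyC size_map_poly.
by rewrite (leq_ltn_trans _ f_nonconst) // leq_b1.
Qed.

(** Composing the factor X - a of f^m - t with f shows that f - a divides f^(m+1) - t, which splits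
    with simple roots. *)
Lemma preimages_split m (a : L) : (m < n)%N -> it m a = t%:A ->
  exists r : {ffun 'I_d -> L},
    (F - a%:P == lead_coef F *: \prod_i ('X - (r i)%:P)) && injectiveb r.
Proof.
move=> ltmn it_a; have [rs Drs] := splits ltmn.
have dvd_F : F - a%:P %| Fi m.+1.
  have : root (Fi m) a by rewrite root_lift_fiter it_a.
  rewrite -dvdp_XsubCl => /dvdpP[q Dq].
  have -> : Fi m.+1 = Fi m \Po F.
    rewrite fiterSr -[t%:P in LHS](comp_polyC t f) -comp_polyB.
    by rewrite /lift_poly map_comp_poly.
  by rewrite Dq comp_polyM comp_polyB comp_polyX comp_polyC dvdp_mulIr.
have [msk Dmsk] : {msk | F - a%:P %= \prod_(z <- mask msk rs) ('X - z%:P)}.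
  by apply: (dvdp_prod_XsubC (F := id)); rewrite -(eqp_dvdr _ Drs).
set r := mask msk rs in Dmsk.
have sz_r : size r = d.
  by have := eqp_size Dmsk; rewrite size_prod_XsubC size_lift_sub => -[].
have uniq_r : uniq r.
  rewrite -separable_prod_XsubC -(eqp_separable Dmsk).
  apply: dvdp_separable dvd_F _.
  by rewrite /lift_poly separable_map sep.
exists [ffun i : 'I_d => r`_i]; apply/andP; split.
  have := eqp_eq Dmsk; rewrite lead_coef_lift_sub (monicP (monic_prod_XsubC _ _ _)).
  rewrite scale1r => ->; apply/eqP; congr (_ *: _).
  rewrite (big_nth 0) big_mkord sz_r; apply: eq_bigr => i _.
  by rewrite ffunE.
apply/injectiveP=> i j; rewrite !ffunE => /eqP.
by rewrite nth_uniq ?sz_r // => /eqP/val_inj.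
Qed.

(** The premise singles out the vertices of level below [n]. Elsewhere every [r] qualifies, so that
    children can be chosen for all elements of [L] at once. *)
Definition is_labelling (a : L) (r : {ffun 'I_d -> L}) : bool :=
  [exists m : 'I_n, it m a == t%:A] ==>
  (F - a%:P == lead_coef F *: \prod_i ('X - (r i)%:P)) && injectiveb r.

Lemma labelling_exists a : exists r, is_labelling a r.
Proof.
rewrite /is_labelling; case: existsP => /= [[m /eqP it_a] | _].
  exact: (preimages_split (ltn_ord m)).
by exists [ffun=> 0].
Qed.

Definition kids (a : L) : 'I_d -> L := xchoose (labelling_exists a).

Definition vtx (w : seq 'I_d) : L := foldl kids t%:A w.

Lemma vtx_rcons w i : vtx (rcons w i) = kids (vtx w) i.
Proof. by rewrite /vtx foldl_rcons. Qed.

Lemma kidsP m (a : L) : (m < n)%N -> it m a = t%:A ->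
  F - a%:P = lead_coef F *: \prod_i ('X - (kids a i)%:P) /\ injective (kids a).
Proof.
move=> ltmn it_a; have /implyP lab := xchooseP (labelling_exists a).
have /lab/andP[/eqP DF /injectiveP //] : [exists m : 'I_n, it m a == t%:A].
by apply/existsP; exists (Ordinal ltmn); rewrite /= it_a.
Qed.

Lemma kids_root m (a x : L) : (m < n)%N -> it m a = t%:A ->
  (F.[x] == a) = [exists i, x == kids a i].
Proof.
move=> ltmn it_a; have [DF _] := kidsP ltmn it_a.
have -> : (F.[x] == a) = root (F - a%:P) x.
  by rewrite /root hornerD hornerN hornerC subr_eq0.
rewrite DF rootZ; last by rewrite lead_coef_eq0 -size_poly_eq0 size_map_poly -lt0n ltnW.
rewrite /root horner_prod prodf_seq_eq0; apply/hasP/existsP=> [[i _] | [i Di]].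
  by rewrite hornerXsubC subr_eq0 => /= xi; exists i.
by exists i; rewrite ?mem_index_enum //= hornerXsubC subr_eq0.
Qed.

Lemma it_vtx w : (size w <= n)%N -> it (size w) (vtx w) = t%:A.
Proof.
elim/last_ind: w => [//|w i IH]; rewrite size_rcons => ltwn.
have it_w := IH (ltnW ltwn); rewrite iterSr.
suff /eqP-> : F.[vtx (rcons w i)] == vtx w by [].
by rewrite (kids_root _ ltwn it_w); apply/existsP; exists i; rewrite vtx_rcons.
Qed.

Lemma vtx_root w x : (size w < n)%N ->
  (F.[x] == vtx w) = [exists i, x == vtx (rcons w i)].
Proof.
move=> ltwn; rewrite (kids_root _ ltwn (it_vtx (ltnW ltwn))).
by apply: eq_existsb => i; rewrite vtx_rcons.
Qed.

Lemma horner_vtx w i : (size w < n)%N -> F.[vtx (rcons w i)] = vtx w.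
Proof. by move=> ltwn; apply/eqP; rewrite vtx_root //; apply/existsP; exists i. Qed.

(** If [y] were longer, the iterates of f from the common vertex would reach t after [size x] steps
    and again after [size y] steps, making t periodic. *)
Lemma vtx_size_inj x y : (size x <= n)%N -> (size y <= n)%N ->
  vtx x = vtx y -> size x = size y.
Proof.
wlog le_xy : x y / (size x <= size y)%N => [Hw | ] sx sy eq_xy.
  case/orP: (leq_total (size x) (size y)) => le; first exact: Hw.
  by apply/esym/Hw.
have := it_vtx sy; rewrite -(subnK le_xy) iterD -eq_xy it_vtx //.
by move/(iter_nonperiodic t_nonper)->.
Qed.

Lemma vtx_inj x y : (size x <= n)%N -> (size y <= n)%N -> vtx x = vtx y -> x = y.
Proof.
move=> sx sy eq_xy; have := vtx_size_inj sx sy eq_xy.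
elim/last_ind: x y sx sy eq_xy => [|x i IH] y sx sy eq_xy; first by case: y {sy eq_xy}.
case/lastP: y sy eq_xy => [|y j] sy eq_xy; first by rewrite size_rcons.
rewrite !size_rcons in sx sy * => -[eq_s].
have Exy : x = y.
  apply: IH => //; try exact: ltnW.
  by rewrite -(horner_vtx i sx) eq_xy horner_vtx.
move: eq_xy; rewrite !vtx_rcons -Exy.
by case: (kidsP sx (it_vtx (ltnW sx))) => _ injk /injk->.
Qed.

Lemma iter_vtx m x : (m <= n)%N -> it m x = t%:A ->
  exists2 w, size w = m & x = vtx w.
Proof.
elim: m x => [|m IH] x ltmn; first by exists [::].
rewrite iterSr => /(IH _ (ltnW ltmn))[w sw /eqP].
rewrite vtx_root ?sw // => /existsP[i /eqP->].
by exists (rcons w i); rewrite ?size_rcons ?sw.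
Qed.

Lemma is_vertexP m x : (m <= n)%N ->
  reflect (exists2 w, (size w <= m)%N & x = vtx w) (is_vertex f t m x).
Proof.
move=> lemn; apply: (iffP existsP) => [[j] | [w sw ->]].
  rewrite root_lift_fiter => /eqP/iter_vtx[|w sw ->].
    by rewrite (leq_trans _ lemn) // -ltnS.
  by exists w; rewrite // sw -ltnS.
exists (Ordinal (sw : (size w < m.+1)%N)); rewrite root_lift_fiter /= it_vtx //.
exact: leq_trans lemn.
Qed.

Lemma parentE x y : (size x <= n)%N -> (size y <= n)%N ->
  (F.[vtx x] == vtx y) = [exists i, x == rcons y i].
Proof.
move=> sx sy; case/lastP: x sx => [|x i] sx.
  have -> : [exists i, [::] == rcons y i] = false.
    by apply/existsP=> -[i]; case: y {sy}.
  (* If f(t) were the vertex of [y], then t would be periodic. *)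
  apply/eqP=> eq_t; have := it_vtx sy; rewrite -eq_t -iterSr.
  by move/(iter_nonperiodic t_nonper).
rewrite size_rcons in sx; rewrite horner_vtx //.
apply/eqP/existsP=> [/vtx_inj-> // | [j]]; try exact: ltnW.
  by exists i.
by rewrite eqseq_rcons => /andP[/eqP-> _].
Qed.

(* [::] on elements that are not vertices. *)
Definition word (x : L) : seq 'I_d :=
  if [pick w : {bseq n of 'I_d} | vtx w == x] is Some w then w else [::].

Lemma wordK w : (size w <= n)%N -> word (vtx w) = w.
Proof.
move=> sw; rewrite /word; case: pickP => [w' /eqP/vtx_inj-> // | /(_ (Bseq sw))].
  exact: size_bseq.
by rewrite eqxx.
Qed.

Lemma vertex_word m (v : vertex L f t m) : (m <= n)%N ->
  (size (word (val v)) <= m)%N /\ val v = vtx (word (val v)).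
Proof.
move=> lemn; have /(is_vertexP _ lemn)[w sw ->] := valP v.
by rewrite wordK // (leq_trans sw).
Qed.

Lemma vertex_of_word m w : (m <= n)%N -> (size w <= m)%N ->
  exists v : vertex L f t m, val v = vtx w.
Proof.
move=> lemn sw; have vw : is_vertex f t m (vtx w) by apply/is_vertexP => //; exists w.
by exists (exist _ (vtx w) vw).
Qed.

(** * Tree automorphisms as maps of words *)

Definition induces m (s : vertex L f t m -> vertex L f t m) S :=
  forall x v, (size x <= m)%N -> val v = vtx x -> val (s v) = vtx (S x).

Lemma word_map_induced m S : (m <= n)%N -> word_map m S ->
  exists s : vertex L f t m -> vertex L f t m, induces s S.
Proof.
move=> lemn mapS.
have vS (v : vertex L f t m) : is_vertex f t m (vtx (S (word (val v)))).
  have [sw _] := vertex_word v lemn; apply/is_vertexP => //.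
  by exists (S (word (val v))); rewrite // (size_word_map mapS).
exists (fun v => exist (fun x => is_vertex f t m x) _ (vS v)) => x v sx /= ->.
by rewrite wordK // (leq_trans sx).
Qed.

Lemma word_map_tree_aut m S S' (s : vertex L f t m -> vertex L f t m) : (m <= n)%N ->
    word_map m S -> word_map m S' ->
    (forall x, (size x <= m)%N -> S' (S x) = x) ->
    (forall x, (size x <= m)%N -> S (S' x) = x) ->
  induces s S -> tree_aut s.
Proof.
move=> lemn mapS mapS' SK S'K sS; have [s' s'S] := word_map_induced lemn mapS'.
have parent_map (R : seq 'I_d -> seq 'I_d) x y : word_map m R -> (size x <= m)%N ->
    [exists i, x == rcons y i] -> [exists i, R x == rcons (R y) i].
  move=> [_ mapR] sx /existsP[i /eqP Dx]; rewrite Dx size_rcons in sx *.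
  by have [k ->] := mapR y i sx; apply/existsP; exists k.
have parentS x y : (size x <= m)%N -> (size y <= m)%N ->
    [exists i, S x == rcons (S y) i] = [exists i, x == rcons y i].
  move=> sx sy; apply/idP/idP; last exact: parent_map.
  by move/(parent_map _ _ _ mapS'); rewrite !SK ?(size_word_map mapS) //; apply.
split.
- exists s' => v; apply: val_inj; have [sw Dv] := vertex_word v lemn.
    by rewrite (s'S _ _ _ (sS _ _ sw Dv)) ?SK ?(size_word_map mapS).
  by rewrite (sS _ _ _ (s'S _ _ sw Dv)) ?S'K ?(size_word_map mapS').
- by move=> v Dv; rewrite (sS [::] v) ?Dv // (proj1 mapS).
move=> v v'; have [sw Dv] := vertex_word v lemn; have [sw' Dv'] := vertex_word v' lemn.
move: (word (val v)) (word (val v')) sw Dv sw' Dv' => x x' sw Dv sw' Dv'.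
rewrite /edge (sS _ _ sw Dv) (sS _ _ sw' Dv') Dv Dv'.
have le w : (size w <= m)%N -> (size w <= n)%N by move/leq_trans; apply.
have sle w : (size w <= m)%N -> (size (S w) <= n)%N.
  by move=> szw; rewrite (size_word_map mapS) ?le.
by rewrite !parentE ?sle ?le // !parentS.
Qed.

Lemma tree_aut_inv m (s : vertex L f t m -> vertex L f t m) : tree_aut s ->
  exists s', [/\ tree_aut s', cancel s s' & cancel s' s].
Proof.
case=> -[s' sK s'K] s0 s_edge; exists s'; split=> //; split.
- by exists s.
- move=> v Dv; have sv : s v = v by apply: val_inj; rewrite [LHS]s0.
  by rewrite -sv sK.
by move=> x y; rewrite -s_edge !s'K.
Qed.

(** Edges are not oriented, so the direction has to be recovered, by induction from the root: a
    child of [x] sent to the parent of [S x] would have the same image as the parent of [x], against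
    injectivity. *)
Lemma tree_aut_word_map m s : (m <= n)%N -> @tree_aut K L f t m s ->
  exists2 S, word_map m S & induces s S.
Proof.
move=> lemn [bij_s s0 s_edge].
pose S x := if insub (vtx x) is Some v then word (val (s v)) else x.
have sS : induces s S.
  move=> x v sx Dv; rewrite /S -Dv valK.
  by have [_ {1}->] := vertex_word (s v) lemn.
have sizeS x : (size x <= m)%N -> (size (S x) <= m)%N.
  move=> sx; have [v Dv] := vertex_of_word lemn sx.
  by rewrite /S -Dv valK; have [] := vertex_word (s v) lemn.
have le w : (size w <= m)%N -> (size w <= n)%N by move/leq_trans; apply.
have injS x y : (size x <= m)%N -> (size y <= m)%N -> S x = S y -> x = y.
  move=> sx sy eqS; have [v Dv] := vertex_of_word lemn sx.
  have [v' Dv'] := vertex_of_word lemn sy.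
  apply: vtx_inj; rewrite ?le // -Dv -Dv'; congr val; apply: (bij_inj bij_s).
  by apply: val_inj; rewrite (sS x) // (sS y) // eqS.
have S0 : S [::] = [::].
  have [v Dv] := @vertex_of_word m [::] lemn isT.
  apply: vtx_inj; rewrite ?le ?sizeS // -(sS [::] v) // s0 //.
have child x i : (size x < m)%N ->
    [exists k, S (rcons x i) == rcons (S x) k] ||
    [exists k, S x == rcons (S (rcons x i)) k].
  move=> sx; have sxi : (size (rcons x i) <= m)%N by rewrite size_rcons.
  have [v Dv] := vertex_of_word lemn sxi.
  have [v' Dv'] := vertex_of_word lemn (ltnW sx).
  have := s_edge v v'; rewrite /edge (sS _ _ sxi Dv) (sS _ _ (ltnW sx) Dv').
  rewrite !parentE ?le ?sizeS ?(ltnW sx) // => ->.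
  by rewrite Dv Dv' horner_vtx ?eqxx // (leq_trans sx).
exists S => //; split=> // x; elim/last_ind: x => [|x j IH] i sx.
  case/orP: (child _ i sx) => /existsP[k /eqP eqS]; first by exists k.
  by move: eqS; rewrite S0; case: (S _).
case/orP: (child _ i sx) => /existsP[k /eqP eqS]; first by exists k.
rewrite size_rcons in sx; have [k' eqS'] := IH j (ltnW sx).
move: eqS; rewrite eqS' => /rcons_inj[/injS eqx _].
have := congr1 size (eqx _ _); rewrite !size_rcons => eq_size.
have := ltnW (ltnW sx); have : (size x < (size x).+2)%N by [].
rewrite -{1}eq_size ?ltnn //; exact: ltnW (ltnW sx).
Qed.

(** * The action of the Galois group *)

Variable Km : nat -> {subfield L}.
Hypothesis splitK : forall m, (m <= n)%N -> splittingFieldFor 1%VS (Fi m) (Km m).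

Lemma deg_gt0 : (0 < d)%N.
Proof. by rewrite -ltnS prednK // ltnW. Qed.

(** The words of length [m] name generators of K_m, and a shorter word is the image under f of any
    of its children; hence the induction on [m - size x]. *)
Lemma vtx_Km m x : (m <= n)%N -> (size x <= m)%N -> vtx x \in Km m.
Proof.
move=> lemn; move Dk: (m - size x)%N => k; elim: k x Dk => [|k IH] x Dk sx.
  have [rs Drs <-] := splitK lemn; apply: seqv_sub_adjoin.
  rewrite -root_prod_XsubC -(eqp_root Drs) root_lift_fiter.
  have <- : size x = m by apply/eqP; rewrite eqn_leq sx -subn_eq0 Dk.
  by rewrite it_vtx // (leq_trans sx).
have ltxm : (size x < m)%N by rewrite -subn_gt0 Dk.
rewrite -(horner_vtx (Ordinal deg_gt0) (leq_trans ltxm lemn)).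
apply: rpred_horner; first exact: alg_polyOver.
by apply: IH; rewrite size_rcons // subnS Dk.
Qed.

Lemma Km_sub m m' : (m <= m')%N -> (m' <= n)%N -> (Km m <= Km m')%VS.
Proof.
move=> le lem'n; have [rs Drs <-] := splitK (leq_trans le lem'n).
apply/Fadjoin_seqP; split=> [|z]; first exact: sub1v.
rewrite -root_prod_XsubC -(eqp_root Drs) root_lift_fiter => /eqP.
case/iter_vtx=> [|w sw ->]; first exact: leq_trans lem'n.
by apply: vtx_Km; rewrite ?sw.
Qed.

Lemma gal_fix_Km m (u : gal_of (Km n)) : (m <= n)%N ->
    (forall x, size x = m -> u (vtx x) = vtx x) ->
  {in Km m, forall z, u z = z}.
Proof.
move=> lemn fix_u z; have [rs Drs Dm] := splitK lemn.
suff /subvP sub : (Km m <= fixedField [set u])%VS.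
  by move/sub => /mem_fixedFieldP[_]; apply; rewrite inE.
rewrite -Dm; apply/Fadjoin_seqP; split=> [|y]; first exact: sub1v.
rewrite -root_prod_XsubC -(eqp_root Drs) root_lift_fiter => /eqP.
case/iter_vtx=> // w sw ->.
apply/fixedFieldP; first by apply: vtx_Km; rewrite ?sw.
by move=> v; rewrite inE => /eqP->; apply: fix_u.
Qed.

Lemma AEnd_horner_lift (u : 'AEnd(L)) x : u F.[x] = F.[u x].
Proof.
rewrite -horner_map; congr (_.[_]); rewrite /lift_poly -map_poly_comp.
by apply: eq_map_poly => a /=; rewrite linearZ /= rmorph1.
Qed.

Lemma AEnd_vtx (u : 'AEnd(L)) x : (size x <= n)%N ->
  size (word (u (vtx x))) = size x /\ u (vtx x) = vtx (word (u (vtx x))).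
Proof.
move=> sx; have it_u m y : u (it m y) = it m (u y).
  by elim: m => //= m IH; rewrite AEnd_horner_lift IH.
have := congr1 u (it_vtx sx); rewrite it_u linearZ /= rmorph1.
by case/(iter_vtx sx)=> w sw ->; rewrite wordK ?sw.
Qed.

Lemma AEnd_word_map (u : 'AEnd(L)) : word_map n (fun x => word (u (vtx x))).
Proof.
split=> [|x i sx].
  have -> : u (vtx [::]) = vtx [::] by rewrite /= linearZ /= rmorph1.
  by rewrite wordK.
have [sux Dux] := AEnd_vtx u (ltnW sx).
have /eqP : F.[u (vtx (rcons x i))] = vtx (word (u (vtx x))).
  by rewrite -AEnd_horner_lift horner_vtx.
rewrite vtx_root ?sux // => /existsP[k /eqP->]; exists k.
by rewrite wordK // size_rcons sux.
Qed.

Lemma gal_invK (u : gal_of (Km n)) x : (size x <= n)%N ->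
  (u^-1)%g (u (vtx x)) = vtx x.
Proof. by move=> sx; rewrite -galM ?vtx_Km // mulgV gal_id. Qed.

(** The half of maximality that always holds; the inverse map of words comes from [u^-1]. *)
Lemma gal_tree_aut (u : gal_of (Km n)) (s : vertex L f t n -> vertex L f t n) :
  (forall v, val (s v) = u (val v)) -> tree_aut s.
Proof.
move=> su; apply: (@word_map_tree_aut n (fun x => word (u (vtx x)))
  (fun x => word ((u^-1)%g (vtx x)))) => //; try exact: AEnd_word_map.
- by move=> x sx; rewrite -(AEnd_vtx u sx).2 gal_invK ?wordK.
- move=> x sx; rewrite -(AEnd_vtx _ sx).2 -{1}(invgK u) gal_invK //.
  exact: wordK.
by move=> x v sx Dv; rewrite su Dv; apply: (AEnd_vtx u sx).2.
Qed.

Lemma AEnd_blocks (u : 'AEnd(L)) w w' : (size w < n)%N -> (size w' < n)%N ->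
    u (vtx w) = vtx w' ->
  exists b : 'S_d, forall i, u (vtx (rcons w i)) = vtx (rcons w' (b i)).
Proof.
move=> sw sw' uw.
have /fin_all_exists[b Db] i : exists k, u (vtx (rcons w i)) = vtx (rcons w' k).
  have /eqP : F.[u (vtx (rcons w i))] = vtx w'.
    by rewrite -AEnd_horner_lift horner_vtx.
  by rewrite vtx_root // => /existsP[k /eqP->]; exists k.
have inj_b : injective b.
  move=> i j eq_b; have : vtx (rcons w i) = vtx (rcons w j).
    by apply: (fmorph_inj u); rewrite /= !Db eq_b.
  by move/vtx_inj; rewrite !size_rcons => /(_ sw sw)/rcons_inj[].
by exists (perm inj_b) => i; rewrite permE.
Qed.

(* The identity if [u] moves [w]. *)
Definition block_perm (w : seq 'I_d) (u : gal_of (Km n)) : 'S_d :=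
  odflt 1%g [pick s : 'S_d | [forall i, u (vtx (rcons w i)) == vtx (rcons w (s i))]].

Lemma block_permP w (u : gal_of (Km n)) i : (size w < n)%N -> u (vtx w) = vtx w ->
  u (vtx (rcons w i)) = vtx (rcons w (block_perm w u i)).
Proof.
move=> sw uw; rewrite /block_perm; case: pickP => [s /forallP/(_ i)/eqP // | no].
have [b Db] := AEnd_blocks sw sw uw.
by have /forallP[] := no b; move=> j; rewrite Db.
Qed.

Lemma block_perm_uniq w (u : gal_of (Km n)) (s : 'S_d) :
    (size w < n)%N -> u (vtx w) = vtx w ->
    (forall i, u (vtx (rcons w i)) = vtx (rcons w (s i))) ->
  block_perm w u = s.
Proof.
move=> sw uw us; apply/permP=> i; have := us i; rewrite block_permP //.
by move/vtx_inj; rewrite !size_rcons => /(_ sw sw)/rcons_inj[].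
Qed.

(** * The group Gal(K_n / K_(n-1)) and its action on the last level *)

Hypothesis n_gt0 : (0 < n)%N.
Local Notation H := ('Gal(Km n / Km n.-1))%g.

Lemma ltn_pred_size (w : seq 'I_d) : (size w <= n.-1)%N -> (size w < n)%N.
Proof. by rewrite -ltnS prednK. Qed.

Lemma gal_fix_vtx h x : h \in H -> (size x <= n.-1)%N -> h (vtx x) = vtx x.
Proof.
move=> Hh sx; apply: (fixed_gal _ Hh); first by rewrite Km_sub ?leq_pred.
by apply: vtx_Km; rewrite ?leq_pred.
Qed.

Lemma mem_gal_pred (u : gal_of (Km n)) :
  (forall x, size x = n.-1 -> u (vtx x) = vtx x) -> u \in H.
Proof.
move=> fix_u; rewrite gal_kHom ?Km_sub ?leq_pred //.
by apply/kAHomP; apply: gal_fix_Km => //; apply: leq_pred.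
Qed.

Lemma block_permM w : size w = n.-1 ->
  {in H &, {morph block_perm w : h k / (h * k)%g}}.
Proof.
move=> sw h k Hh Hk; have ltw : (size w < n)%N by rewrite ltn_pred_size ?sw.
have fix_w g : g \in H -> g (vtx w) = vtx w by move=> Hg; rewrite gal_fix_vtx ?sw.
apply: block_perm_uniq => // [|i]; first by rewrite fix_w ?groupM.
rewrite galM ?vtx_Km ?size_rcons //.
by rewrite (block_permP _ ltw (fix_w h Hh)) (block_permP _ ltw (fix_w k Hk)) permM.
Qed.

(** Normality of [H]: [g] permutes the vertices of level [n.-1], and [h] fixes them all. *)
Lemma gal_predJ h (g : gal_of (Km n)) : h \in H -> (h ^ g)%g \in H.
Proof.
move=> Hh; apply: mem_gal_pred => x sx.
have sx' : (size x <= n)%N by rewrite sx leq_pred.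
have [su Du] := AEnd_vtx (g^-1)%g sx'.
rewrite conjgE !galM ?memv_gal ?vtx_Km // Du gal_fix_vtx ?su ?sx //.
by rewrite -Du -{1}(invgK g) gal_invK.
Qed.

(** Products act from the left factor on: [h ^ g^-1] first takes the block of [x] to that of [y] by
    [g], then applies [h] there, then comes back. *)
Lemma block_permJ h (g : gal_of (Km n)) x y (b : 'S_d) :
    h \in H -> size x = n.-1 -> size y = n.-1 ->
    (forall i, g (vtx (rcons x i)) = vtx (rcons y (b i))) ->
  block_perm x (h ^ g^-1)%g = (block_perm y h ^ b^-1)%g.
Proof.
move=> Hh sx sy gb; have ltx : (size x < n)%N by rewrite ltn_pred_size ?sx.
apply: block_perm_uniq => // [|i]; first by rewrite gal_fix_vtx ?gal_predJ ?sx.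
rewrite conjgE invgK !galM ?memv_gal ?vtx_Km ?size_rcons // gb.
have lty : (size y < n)%N by rewrite ltn_pred_size ?sy.
have hy : h (vtx y) = vtx y by rewrite gal_fix_vtx ?sy.
rewrite (block_permP _ lty hy).
set k := block_perm y h (b i).
have -> : vtx (rcons y k) = g (vtx (rcons x ((b^-1)%g k))) by rewrite gb permKV.
rewrite gal_invK ?size_rcons //; congr (vtx (rcons x _)).
by rewrite conjgE invgK !permM.
Qed.

(** * Odd elements of Gal(K_n / K_(n-1)) and maximality *)

Local Notation word_tuple := (n.-1.-tuple 'I_d).

Hypothesis deg_even : ~~ odd d.
Hypothesis max_pred : maximal_ext f t n.-1 (Km n.-1).

Lemma galois_Kn : galois 1 (Km n).
Proof.
apply/splitting_galoisField; exists (Fi n); split; last exact: splitK.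
  exact: (alg_polyOver 1%AS).
by rewrite /lift_poly separable_map sep.
Qed.

Lemma gal_extends (u : gal_of (Km n.-1)) :
  exists g : gal_of (Km n), {in Km n.-1, g =1 u}.
Proof.
have sN : (Km n.-1 <= Km n)%VS by rewrite Km_sub ?leq_pred.
have /and3P[_ _ nKn] := galois_Kn.
have [|g _ gu] := kHom_to_gal _ nKn (k1AHom (Km n.-1) (u : 'AEnd(L))).
  by rewrite sub1v.
by exists g => z Mz; rewrite -gu.
Qed.

(** Maximality of K_(n-1) enters here: it provides an automorphism of K_(n-1), which extends to the
    normal extension K_n. *)
Lemma gal_word_map S S' : word_map n.-1 S -> word_map n.-1 S' ->
    (forall x, (size x <= n.-1)%N -> S' (S x) = x) ->
    (forall x, (size x <= n.-1)%N -> S (S' x) = x) ->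
  exists g : gal_of (Km n), forall x, (size x <= n.-1)%N -> g (vtx x) = vtx (S x).
Proof.
move=> mapS mapS' SK S'K; have [s sS] := word_map_induced (leq_pred n) mapS.
have aut_s := word_map_tree_aut (leq_pred n) mapS mapS' SK S'K sS.
have [u _ us] := (max_pred s).1 aut_s; have [g gu] := gal_extends u.
exists g => x sx; have [v Dv] := vertex_of_word (leq_pred n) sx.
by rewrite gu ?vtx_Km ?leq_pred // -Dv -us (sS x).
Qed.

(** The sign vectors of [H] are closed under addition because [H] is a group, and under node moves
    because conjugating by an element that realises the move permutes the blocks and keeps their
    signs. *)
Lemma gal_signs_full :
    (exists2 h, h \in H &
       \big[addb/false]_(w : word_tuple) odd_perm (block_perm w h)) ->
  forall e : word_tuple -> bool,
  exists2 h, h \in H & forall w : word_tuple, odd_perm (block_perm w h) = e w.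
Proof.
move=> [h0 Hh0 odd_h0] e.
pose W (v : seq 'I_d -> bool) := exists2 h, h \in H &
  forall w, size w = n.-1 -> odd_perm (block_perm w h) = v w.
(* [e] is extended by [false] to words of other lengths. *)
suffices [h Hh he] : W (fun w => oapp e false (insub w)).
  by exists h => // w; rewrite he ?size_tuple // valK.
apply: (@odd_submodule_full _ n.-1).
- by rewrite card_ord.
- by move=> v v' vv' [h Hh hv]; exists h => // w sw; rewrite hv ?vv'.
- move=> v v' [h Hh hv] [k Hk kv]; exists (h * k)%g; first exact: groupM.
  by move=> w sw; rewrite block_permM // odd_permM hv ?kv.
- move=> v w p sw [h Hh hv].
  have [g gw] := gal_word_map (node_move_word_map _ w p)
    (node_move_word_map _ w p^-1) (fun x _ => node_moveK w p x)
    (fun x _ => node_moveKV w p x).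
  exists (h ^ g^-1)%g; first by apply: gal_predJ.
  move=> x sx; have smx : size (node_move w p x) = n.-1 by rewrite size_node_move.
  have ltx : (size x < n)%N by rewrite ltn_pred_size ?sx.
  have ltmx : (size (node_move w p x) < n)%N by rewrite size_node_move.
  have gx : g (vtx x) = vtx (node_move w p x) by rewrite gw ?sx.
  have [b gb] := AEnd_blocks ltx ltmx gx.
  by rewrite (block_permJ Hh sx smx gb) odd_permJ hv.
by exists (fun w => odd_perm (block_perm w h0)) => //; exists h0.
Qed.

Hypothesis gal_alpha : forall alpha : L, root (Fi n.-1) alpha ->
  gal_sym_or_alt <<1; alpha>>%AS (F - alpha%:P).

(** [H] fixes K(alpha_w), which lies in K_(n-1), so an odd element excludes A_d. With S_d available,
    every permutation of the block is induced over K(alpha_w) and conjugates the image of [H] into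
    itself. *)
Lemma block_perm_onto w : size w = n.-1 ->
    (exists2 h, h \in H & odd_perm (block_perm w h)) ->
  forall s, exists2 h, h \in H & block_perm w h = s.
Proof.
move=> sw [h0 Hh0 odd_h0] s.
have ltw : (size w < n)%N by rewrite ltn_pred_size ?sw.
have it_w := it_vtx (ltnW ltw).
have fix_w h : h \in H -> h (vtx w) = vtx w by move=> Hh; rewrite gal_fix_vtx ?sw.
have [DF inj_kids] := kidsP ltw it_w.
have nzF : F - (vtx w)%:P != 0 by rewrite -size_poly_eq0 size_lift_sub.
have inj_w : injective (fun i => vtx (rcons w i)).
  by move=> i j; rewrite !vtx_rcons => /inj_kids.
have Dw : F - (vtx w)%:P = lead_coef (F - (vtx w)%:P) *:
    \prod_i ('X - (vtx (rcons w i))%:P).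
  rewrite lead_coef_lift_sub DF; congr (_ *: _).
  by apply: eq_bigr => i _; rewrite vtx_rcons.
have galw : gal_sym_or_alt <<1; vtx w>>%AS (F - (vtx w)%:P).
  by apply: gal_alpha; rewrite root_lift_fiter -sw it_w.
have [sym | alt] := gal_sym_or_alt_labels nzF inj_w Dw galw; last first.
  suff: ~~ odd_perm (block_perm w h0) by rewrite odd_h0.
  apply: (alt (h0 : 'AEnd(L))) => [x x_in | i].
    apply: (fixed_gal _ Hh0); first by rewrite Km_sub ?leq_pred.
    apply: subvP x x_in; apply/FadjoinP; split; first exact: sub1v.
    by apply: vtx_Km; rewrite ?leq_pred ?sw.
  by rewrite (block_permP _ ltw (fix_w _ Hh0)).
pose phi := Morphism (block_permM sw).
have /morphimP[h _ Hh ->] : s \in [group of phi @* H]%g; last by exists h.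
apply: (normal_odd_full _ (mem_morphim phi Hh0 Hh0)) => //.
move=> p _ /morphimP[h _ Hh ->].
(* The inverse, because [block_permJ] conjugates by the inverse of the permutation that [g]
   induces. *)
have [g0 g0fix g0r] := sym p^-1%g.
have /and3P[_ _ nKn] := galois_Kn.
have [|g _ gg0] := kHom_to_gal _ nKn (k1AHom (Km n) g0).
  by rewrite sub1v subvv.
have gr i : g (vtx (rcons w i)) = vtx (rcons w (p^-1%g i)).
  by rewrite -gg0 ?g0r // vtx_Km ?size_rcons.
have Hhg := gal_predJ g^-1%g Hh.
have := block_permJ Hh sw sw gr; rewrite invgK => <-.
exact: (mem_morphim phi Hhg Hhg).
Qed.

Lemma gal_blocks_full :
    (exists2 h, h \in H &
       \big[addb/false]_(w : word_tuple) odd_perm (block_perm w h)) ->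
  forall p : word_tuple -> 'S_d,
  exists2 h, h \in H & forall w : word_tuple, block_perm w h = p w.
Proof.
move=> odd_h; have signs := gal_signs_full odd_h.
apply: (@subdirect_perm_full _ _ _ _
  (fun w : word_tuple => Morphism (block_permM (size_tuple w)))) => //=.
move=> w; apply: block_perm_onto; first exact: size_tuple.
by have [h Hh he] := signs xpredT; exists h; rewrite ?he.
Qed.

(** Some [g] agrees with the given automorphism up to level [n.-1]; an element of [H] applied before
    it corrects the action inside each last block. *)
Lemma odd_gal_maximal :
    (exists2 h, h \in H &
       \big[addb/false]_(w : word_tuple) odd_perm (block_perm w h)) ->
  maximal_ext f t n (Km n).
Proof.
move=> /gal_blocks_full blocks s; split; last first.
  by case=> u _ us; apply: gal_tree_aut us.
move=> aut_s; have [s' [aut_s' sK s'K]] := tree_aut_inv aut_s.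
have [S mapS sS] := tree_aut_word_map (leqnn n) aut_s.
have [S' mapS' sS'] := tree_aut_word_map (leqnn n) aut_s'.
have cancel_words s1 s2 S1 S2 : word_map n S1 -> word_map n S2 ->
    @induces n s1 S1 -> @induces n s2 S2 -> cancel s1 s2 ->
    forall x, (size x <= n)%N -> S2 (S1 x) = x.
  move=> map1 map2 ind1 ind2 s12K x sx.
  have [v Dv] := vertex_of_word (leqnn n) sx.
  have s1x : (size (S1 x) <= n)%N by rewrite (size_word_map map1).
  apply: vtx_inj; rewrite ?(size_word_map map2) //.
  by rewrite -(ind2 _ (s1 v)) ?s12K //; apply: ind1.
have SK := cancel_words _ _ _ _ mapS mapS' sS sS' sK.
have S'K := cancel_words _ _ _ _ mapS' mapS sS' sS s'K.
have le (x : seq 'I_d) : (size x <= n.-1)%N -> (size x <= n)%N.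
  by move=> /leq_trans; apply; apply: leq_pred.
have [g gS] := gal_word_map (word_mapW (leq_pred n) mapS)
  (word_mapW (leq_pred n) mapS')
  (fun x sx => SK x (le x sx)) (fun x sx => S'K x (le x sx)).
(* [p w] is the correction needed below [w] before [g] is applied. *)
have /fin_all_exists[p Dp] (w : word_tuple) : exists p : 'S_d,
    forall i, g (vtx (rcons w (p i))) = vtx (S (rcons w i)).
  have sw : (size w <= n.-1)%N by rewrite size_tuple.
  have ltw := ltn_pred_size sw.
  have ltSw : (size (S w) < n)%N by rewrite (size_word_map mapS) // ltnW.
  have [b Db] := AEnd_blocks ltw ltSw (gS w sw).
  have /fin_all_exists[c Dc] i : exists k, S (rcons w i) = rcons (S w) k.
    exact: mapS.2.
  have inj_c : injective c.
    move=> i j eq_c; have : rcons w i = rcons w j.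
      by rewrite -[LHS]SK ?size_rcons // -[RHS]SK ?size_rcons // !Dc eq_c.
    by case/rcons_inj.
  exists (perm inj_c * b^-1)%g => i.
  by rewrite Db permM permKV permE Dc.
have [h Hh hp] := blocks p; exists (h * g)%g.
  by rewrite gal_kHom ?sub1v // k1AHom.
move=> v; have [sx Dv] := vertex_word v (leqnn n).
rewrite (sS _ _ sx Dv) Dv; move: (word _) sx {Dv} => x sx.
rewrite galM ?vtx_Km //; have [lex | ltx] := leqP (size x) n.-1.
  by rewrite gal_fix_vtx // wordK ?le // gS.
rewrite wordK //.
case/lastP: x => [|w i] in sx ltx *; first by rewrite ltn0 in ltx.
rewrite size_rcons in sx ltx *; have sw : size w == n.-1.
  by rewrite eqn_leq -[X in X && _]ltnS prednK // sx -ltnS.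
have hw : h (vtx w) = vtx w by rewrite gal_fix_vtx ?(eqP sw).
rewrite (block_permP _ sx hw).
by have := hp (Tuple sw) => /= ->; have := Dp (Tuple sw) i => /= ->.
Qed.

(** The exchange of two leaves below one vertex is realised; it fixes level [n.-1] and has exactly
    one odd block. Two leaves exist since d is even and positive. *)
Lemma maximal_odd_gal : maximal_ext f t n (Km n) ->
  exists2 h, h \in H &
    \big[addb/false]_(w : word_tuple) odd_perm (block_perm w h).
Proof.
move=> max_n; have d_gt1 : (1 < d)%N.
  by have := deg_gt0; case: d deg_even => [|[]].
pose i0 := Ordinal deg_gt0; pose i1 := Ordinal d_gt1.
pose w0 : word_tuple := [tuple of nseq n.-1 i0].
pose S := node_move w0 (tperm i0 i1).
have mapS := node_move_word_map n w0 (tperm i0 i1).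
have [s sS] := word_map_induced (leqnn n) mapS.
have aut_s : tree_aut s.
  apply: (word_map_tree_aut (leqnn n) mapS mapS _ _ sS) => x _;
    by rewrite -{1}tpermV node_moveK.
have [u _ us] := (max_n s).1 aut_s.
have uS x : (size x <= n)%N -> u (vtx x) = vtx (S x).
  by move=> sx; have [v Dv] := vertex_of_word (leqnn n) sx; rewrite -Dv -us (sS x).
have fix_u x : size x = n.-1 -> u (vtx x) = vtx x.
  move=> sx; rewrite uS ?sx ?leq_pred // /S node_move_short //.
  by rewrite size_tuple sx.
exists u; first exact: mem_gal_pred.
have blockE (w : word_tuple) :
    block_perm w u = if w == w0 then tperm i0 i1 else 1%g.
  have sw : (size w <= n.-1)%N by rewrite size_tuple.
  apply: block_perm_uniq; rewrite ?ltn_pred_size ?fix_u ?size_tuple // => i.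
  rewrite uS ?size_rcons ?ltn_pred_size // /S.
  rewrite node_move_rcons node_move_short ?size_tuple //.
  by rewrite val_eqE; case: ifP => // _; rewrite perm1.
rewrite (bigD1 w0) //= big1 => [|w /negPf ww0]; last by rewrite blockE ww0 odd_perm1.
by rewrite blockE eqxx odd_tperm.
Qed.

(** * The discriminant *)

Variable rs : seq L.
Hypothesis rootsn : roots_of (Fi n) rs.

Lemma lead_coef_Fi_neq0 : lead_coef (Fi n) != 0.
Proof.
rewrite lead_coef_eq0; apply: separable_poly_neq0.
by rewrite /lift_poly separable_map sep.
Qed.

Lemma mem_roots x : x \in rs = root (Fi n) x.
Proof. by rewrite rootsn rootZ ?lead_coef_Fi_neq0 // root_prod_XsubC. Qed.

Lemma vtx_roots w : size w = n -> vtx w \in rs.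
Proof. by move=> sw; rewrite mem_roots root_lift_fiter -sw it_vtx ?sw. Qed.

Lemma uniq_roots_Fi : uniq rs.
Proof.
have : separable_poly (Fi n) by rewrite /lift_poly separable_map sep.
rewrite rootsn (eqp_separable (eqp_scale _ lead_coef_Fi_neq0)).
by rewrite separable_prod_XsubC.
Qed.

(** The product of the differences of the roots, as a determinant: a permutation of the roots
    permutes the columns, so its sign can be read off. *)
Definition vandermonde : L := \det (Vandermonde (size rs) (\row_i rs`_i)).

Lemma disc_vandermonde :
  disc (Fi n) rs = (lead_coef (Fi n) ^+ (size rs).-1 * vandermonde) ^+ 2.
Proof.
rewrite /disc exprMn mulnC exprM; congr (_ * _).
rewrite /vandermonde det_Vandermonde -prodrXl; apply: eq_bigr => i _.
rewrite -prodrXl; apply: eq_bigr => j _.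
by rewrite !mxE -sqrrN opprB.
Qed.

Lemma vandermonde_neq0 : vandermonde != 0.
Proof.
rewrite /vandermonde det_Vandermonde; apply/prodf_neq0 => i _.
apply/prodf_neq0 => j ltij; rewrite !mxE subr_eq0.
by rewrite nth_uniq ?uniq_roots_Fi // gtn_eqF.
Qed.

Lemma vandermonde_in : vandermonde \in Km n.
Proof.
rewrite /vandermonde det_Vandermonde; apply: rpred_prod => i _.
apply: rpred_prod => j _; rewrite !mxE.
have rsK k : (k < size rs)%N -> rs`_k \in Km n.
  move=> ltk; have := mem_nth 0 ltk; rewrite mem_roots root_lift_fiter => /eqP.
  by case/(iter_vtx (leqnn n))=> w sw ->; rewrite vtx_Km ?sw.
by rewrite rpredB ?rsK.
Qed.

(** [h] permutes the roots block by block, so [odd_perm_block] turns the sign of the column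
    permutation into the product of the block signs. *)
Lemma gal_vandermonde h : h \in H ->
  h vandermonde =
  (-1) ^+ (\big[addb/false]_(w : word_tuple) odd_perm (block_perm w h)) * vandermonde.
Proof.
move=> Hh.
have fix_w (w : word_tuple) : h (vtx w) = vtx w by rewrite gal_fix_vtx ?size_tuple.
have ltw (w : word_tuple) : (size w < n)%N by rewrite ltn_pred_size ?size_tuple.
have szr (w : word_tuple) i : size (rcons w i) = n.
  by rewrite size_rcons size_tuple prednK.
have in_rs (wi : word_tuple * 'I_d) : (index (vtx (rcons wi.1 wi.2)) rs < size rs)%N.
  by rewrite index_mem vtx_roots.
pose e wi := Ordinal (in_rs wi).
have eE wi : rs`_(e wi) = vtx (rcons wi.1 wi.2) by rewrite nth_index // vtx_roots.
have inj_e : injective e.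
  move=> [w i] [w' i'] /(congr1 (fun j : 'I_(size rs) => rs`_j)).
  rewrite !eE /= => /vtx_inj; rewrite !szr.
  move=> /(_ (leqnn n) (leqnn n))/rcons_inj[eq_w ->].
  by congr (_, _); apply: val_inj.
(* Since [n] is positive, every root is named by a word with a last letter. *)
have /fin_all_exists[e' De'] (j : 'I_(size rs)) : exists wi, e wi = j.
  have := mem_nth 0 (ltn_ord j); rewrite mem_roots root_lift_fiter => /eqP.
  case/(iter_vtx (leqnn n)); case/lastP=> [|w i] sw Dj.
    by have := n_gt0; rewrite -{1}sw.
  have sw' : size w == n.-1 by rewrite -sw size_rcons.
  exists (Tuple sw', i); apply/val_inj/eqP => /=.
  rewrite -(nth_uniq 0 _ _ uniq_roots_Fi) ?index_mem ?vtx_roots //.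
  by rewrite nth_index ?vtx_roots // Dj.
have eK : cancel e e' by move=> wi; apply: inj_e; rewrite De'.
have bij_e : bijective e by exists e'.
pose blk (wi : word_tuple * 'I_d) := (wi.1, block_perm wi.1 h wi.2).
have inj_s : injective (fun j => e (blk (e' j))).
  move=> j j' /inj_e eq_blk; apply: (can_inj De').
  by case: (e' j) (e' j') eq_blk => [w i] [w' i'] /= [-> /perm_inj->].
have <- : odd_perm (perm inj_s) =
    \big[addb/false]_(w : word_tuple) odd_perm (block_perm w h).
  apply: (odd_perm_block bij_e) => w i.
  by rewrite permE eK.
rewrite /vandermonde -det_map_mx.
have -> : map_mx h (Vandermonde (size rs) (\row_i rs`_i)) =
    col_perm (perm inj_s) (Vandermonde (size rs) (\row_i rs`_i)).
  apply/matrixP=> i j; rewrite !mxE rmorphXn /=; congr (_ ^+ _).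
  rewrite permE -{1}(De' j) !eE /=; case: (e' j) => w k /=.
  exact: block_permP.
by rewrite col_permE det_mulmx det_perm odd_permV mulrC.
Qed.

Hypothesis char_not2 : 2%N \notin [pchar K].

(** A square root in K_(n-1) is fixed by [h], yet it is up to sign a multiple of [vandermonde] by a
    power of the leading coefficient, which [h] negates. That multiple is nonzero by separability,
    and 2 is nonzero in K. *)
Lemma odd_gal_not_square h : h \in H ->
    \big[addb/false]_(w : word_tuple) odd_perm (block_perm w h) ->
  ~ nonzero_square_in (Km n.-1) (disc (Fi n) rs).
Proof.
move=> Hh odd_h [y [My _]]; rewrite disc_vandermonde => /eqP.
rewrite eqf_sqr; set c := lead_coef _ ^+ _ => cV.
have hy : h y = y by apply: (fixed_gal _ Hh) => //; rewrite Km_sub ?leq_pred.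
have hc : h c = c.
  rewrite /c rmorphXn /= lead_coef_map /=; congr (_ ^+ _).
  by rewrite linearZ /= rmorph1.
have hV : h (c * vandermonde) = - (c * vandermonde).
  by rewrite rmorphM /= hc gal_vandermonde // odd_h expr1 mulN1r mulrN.
have nz_cV : c * vandermonde != 0.
  by rewrite mulf_neq0 ?vandermonde_neq0 // expf_neq0 ?lead_coef_Fi_neq0.
have : c * vandermonde = - (c * vandermonde).
  rewrite -{1}hV; case/orP: cV => /eqP ->; last rewrite rmorphN /=; by rewrite hy.
move/eqP; rewrite -addr_eq0 -mulr2n -mulr_natr mulf_eq0 (negPf nz_cV) /=.
apply/negP; apply: contra char_not2 => two0; rewrite inE /=.
by rewrite -(fmorph_eq0 (in_alg L)) rmorph_nat.
Qed.

(** Otherwise all of [H] fixes [vandermonde], which then lies in K_(n-1) by the Galois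
    correspondence and gives a square root of the discriminant. *)
Lemma not_square_odd_gal : ~ nonzero_square_in (Km n.-1) (disc (Fi n) rs) ->
  exists2 h, h \in H &
    \big[addb/false]_(w : word_tuple) odd_perm (block_perm w h).
Proof.
move=> not_sq; apply/exists_inP; apply: contraT => /exists_inPn even_H.
have sME : (Km n.-1 <= Km n)%VS by rewrite Km_sub ?leq_pred.
have /galois_fixedField fixM : galois (Km n.-1) (Km n).
  by apply: galoisS galois_Kn; rewrite sub1v.
have MV : vandermonde \in Km n.-1.
  rewrite -fixM; apply/fixedFieldP; first exact: vandermonde_in.
  by move=> h Hh; rewrite gal_vandermonde // (negPf (even_H h Hh)) mul1r.
case: not_sq; exists (lead_coef (Fi n) ^+ (size rs).-1 * vandermonde).
split; last exact: disc_vandermonde.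
  rewrite rpredM // rpredX // lead_coef_map /=.
  exact: (subvP (sub1v _)) (memvZ _ (mem1v _)).
by rewrite mulf_neq0 ?vandermonde_neq0 // expf_neq0 ?lead_coef_Fi_neq0.
Qed.

End Labels.

(** * The discriminant criterion for maximality *)

Theorem theorem2p4 (K : fieldType) (f : {poly K}) (t : K) (n : nat)
    (L : splittingFieldType K) (Km : nat -> {subfield L}) (rs : seq L)
    (char_not2 : 2%N \notin [pchar K])
    (f_nonconst : (1 < size f)%N)
    (deg_even : ~~ odd (size f).-1)
    (t_nonper : ~ periodic f t)
    (sep : forall m : nat, (0 < m)%N -> separable_poly (fiter f m - t%:P))
    (n_gt0 : (0 < n)%N)
    (splitK : forall m : nat, (m <= n)%N ->
       splittingFieldFor 1%VS (lift_poly L (fiter f m - t%:P)) (Km m))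
    (rootsn : roots_of (lift_poly L (fiter f n - t%:P)) rs)
    (max_pred : maximal_ext f t n.-1 (Km n.-1))
    (irr_alpha : forall alpha : L,
       root (lift_poly L (fiter f n.-1 - t%:P)) alpha ->
       irreducible_over <<1; alpha>>%AS (lift_poly L f - alpha%:P))
    (gal_alpha : forall alpha : L,
       root (lift_poly L (fiter f n.-1 - t%:P)) alpha ->
       gal_sym_or_alt <<1; alpha>>%AS (lift_poly L f - alpha%:P)) :
  maximal_ext f t n (Km n) <->
  ~ nonzero_square_in (Km n.-1) (disc (lift_poly L (fiter f n - t%:P)) rs).
Proof.
have splits m (lemn : (m <= n)%N) : exists zs : seq L,
    lift_poly L (fiter f m - t%:P) %= \prod_(z <- zs) ('X - z%:P).
  by have [zs Dzs _] := splitK m lemn; exists zs.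
split=> [max_n | not_sq].
  have [h Hh odd_h] := maximal_odd_gal f_nonconst t_nonper sep
    splits splitK n_gt0 deg_even max_n.
  exact: odd_gal_not_square odd_h.
have odd_h := not_square_odd_gal f_nonconst t_nonper sep splits splitK n_gt0
  rootsn not_sq.
exact: odd_gal_maximal odd_h.
Qed.
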